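(* For every integer $T\ge 3$, the semigroup $\mathbb N A^T$ generated by the columns of $A^T$ is normal, i.e. $\mathbb N A^T=\mathbb Z A^T\cap \mathrm{cone}(A^T)$.
   Context: For an integer $T\ge 2$, let $\Omega_T$ be the set of words $w=s_1s_2\cdots s_T$ over the alphabet $\{1,2,3\}$ with $s_l\neq s_{l+1}$ for $l=1,\dots,T-1$. For $w\in\Omega_T$ and an ordered pair $ij$ with $i\neq j$, let $x_{ij}(w)$ be the number of indices $1\le l\le T-1$ with $s_ls_{l+1}=ij$. The design matrix $A^T$ is the $6\times 3\cdot 2^{T-1}$ matrix whose column indexed by $w\in\Omega_T$ is $[x_{12}(w),x_{13}(w),x_{21}(w),x_{23}(w),x_{31}(w),x_{32}(w)]$. $\mathbb N A^T$ denotes the set of nonnegative integer combinations of the columns, $\mathbb ZA^T$ the set of integer combinations, and $\mathrm{cone}(A^T)$ the set of nonnegative real combinations. *)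

(* Defs.v *)
From HB Require Import structures.
From mathcomp Require Import all_boot all_order all_algebra.
From mathcomp Require Import reals.
Set Implicit Arguments. Unset Strict Implicit. Unset Printing Implicit Defensive.
Import Order.TTheory GRing.Theory Num.Theory.
Local Open Scope ring_scope.

(* Letters 1,2,3 are encoded as the elements 0,1,2 of 'I_3. *)
Definition letter := 'I_3.

Definition is_word (T : nat) (w : T.-tuple letter) : bool :=
  [forall l : 'I_T.-1, nth ord0 w l != nth ord0 w l.+1].

Definition xcount (T : nat) (i j : letter) (w : T.-tuple letter) : nat :=
  #|[set l : 'I_T.-1 | (nth ord0 w l == i) && (nth ord0 w l.+1 == j)]|.

Definition row_pair (k : 'I_6) : letter * letter :=
  nth (ord0, ord0)
    [:: (inord 0, inord 1); (inord 0, inord 2); (inord 1, inord 0);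
        (inord 1, inord 2); (inord 2, inord 0); (inord 2, inord 1)] k.

Definition Aentry (T : nat) (k : 'I_6) (w : T.-tuple letter) : nat :=
  xcount (row_pair k).1 (row_pair k).2 w.

Definition in_NA (T : nat) (v : 'I_6 -> int) : Prop :=
  exists c : T.-tuple letter -> nat,
    forall k, v k = \sum_(w : T.-tuple letter | is_word w) ((c w * Aentry k w)%N)%:Z.

Definition in_ZA (T : nat) (v : 'I_6 -> int) : Prop :=
  exists c : T.-tuple letter -> int,
    forall k, v k = \sum_(w : T.-tuple letter | is_word w) c w * (Aentry k w)%:Z.

Definition in_cone (R : realType) (T : nat) (v : 'I_6 -> int) : Prop :=
  exists c : T.-tuple letter -> R,
    (forall w, 0 <= c w) /\
    forall k, (v k)%:~R = \sum_(w : T.-tuple letter | is_word w) c w * (Aentry k w)%:R.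

(* Main.v *)
Require Import Defs.
From HB Require Import structures.
From mathcomp Require Import all_boot all_order all_algebra.
From mathcomp Require Import reals.
From mathcomp Require Import zify.
Import Order.TTheory GRing.Theory Num.Theory.
Set Implicit Arguments.
Unset Strict Implicit.
Local Open Scope ring_scope.

(* Put n = T - 1. As a loopless multigraph on three vertices is connected apart from
   isolated vertices, Euler's theorem says that a vector x of edge counts is the count of
   a word iff x >= 0, |x| = n and the skew part t = (x12 - x21, x23 - x32, x31 - x13)
   has entries differing by at most 1.  The same theorem, applied to a long trail which is
   then cut, splits x into N words when |x| = nN and the t_i differ by at most 1.

   Let now |x| = nN and, up to symmetry, t = (z + b, z, z - a) with a, b, z >= 0. We look
   for b trails with t = (k + 1, k, k) and a trails with t = (k, k, k - 1), of length n or
   2n, the remaining edges forming a balanced flow. For a trail of length L the number k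
   has the parity of L + 1 and is bounded by about L / 3; once the k's are chosen with sum
   close to z, each trail is padded with two-cycles, which can be taken from anywhere. The
   few linear inequalities needed for the k's to exist depend on n mod 2 and n mod 3 only.
   They are homogeneous forms of inequalities valid for all words, so they hold on the
   cone. *)

(** * Edge-count vectors and Euler trails on three vertices *)

(* The edges of the cycle 1 -> 2 -> 3 -> 1 come first, then the reversed ones. *)
Record flow := Flow { x12 : int; x23 : int; x31 : int; x21 : int; x32 : int; x13 : int }.

Definition fzero := Flow 0 0 0 0 0 0.

Definition fadd (x y : flow) :=
  Flow (x12 x + x12 y) (x23 x + x23 y) (x31 x + x31 y)
       (x21 x + x21 y) (x32 x + x32 y) (x13 x + x13 y).

Definition fsub (x y : flow) :=
  Flow (x12 x - x12 y) (x23 x - x23 y) (x31 x - x31 y)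
       (x21 x - x21 y) (x32 x - x32 y) (x13 x - x13 y).

Lemma faddA (x y z : flow) : fadd x (fadd y z) = fadd (fadd x y) z.
Proof. by rewrite /fadd /=; congr Flow; lia. Qed.

Lemma fadd0 (x : flow) : fadd fzero x = x.
Proof. by case: x => * /=; rewrite /fadd /=; congr Flow; lia. Qed.

Lemma faddBK (x y : flow) : fadd y (fsub x y) = x.
Proof. by case: x y => ? ? ? ? ? ? [? ? ? ? ? ?]; rewrite /fadd /=; congr Flow; lia. Qed.

Definition flen (x : flow) := x12 x + x23 x + x31 x + x21 x + x32 x + x13 x.

Definition nonneg (x : flow) :=
  [&& 0 <= x12 x, 0 <= x23 x, 0 <= x31 x, 0 <= x21 x, 0 <= x32 x & 0 <= x13 x].

Definition t12 (x : flow) := x12 x - x21 x.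
Definition t23 (x : flow) := x23 x - x32 x.
Definition t31 (x : flow) := x31 x - x13 x.

(* The net out-degrees of the three vertices are the differences of the [t]'s,
   so this says that [x] is a nonnegative edge count of length [L] having at
   most one source and one sink, both of excess one. *)
Definition trailvec (L : nat) (x : flow) :=
  [&& nonneg x, flen x == L%:Z, `|t12 x - t31 x| <= 1,
      `|t23 x - t12 x| <= 1 & `|t31 x - t23 x| <= 1].

Definition edge (i j : letter) : flow :=
  Flow (((i == 0 :> nat) && (j == 1 :> nat))%N : nat)%:Z
       (((i == 1 :> nat) && (j == 2 :> nat))%N : nat)%:Z
       (((i == 2 :> nat) && (j == 0 :> nat))%N : nat)%:Z
       (((i == 1 :> nat) && (j == 0 :> nat))%N : nat)%:Z
       (((i == 2 :> nat) && (j == 1 :> nat))%N : nat)%:Z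
       (((i == 0 :> nat) && (j == 2 :> nat))%N : nat)%:Z.

Fixpoint wflow (s : letter) (p : seq letter) : flow :=
  if p is u :: p' then fadd (edge s u) (wflow u p') else fzero.

Definition neq_letter : rel letter := fun i j => i != j.

Lemma wflow_cat (s : letter) (p q : seq letter) :
  wflow s (p ++ q) = fadd (wflow s p) (wflow (last s p) q).
Proof. by elim: p s => [|u p IH] s /=; rewrite ?fadd0 // IH faddA. Qed.

Lemma letterP (P : letter -> Prop) :
  P (@Ordinal 3 0 isT) -> P (@Ordinal 3 1 isT) -> P (@Ordinal 3 2 isT) -> forall i, P i.
Proof.
move=> P0 P1 P2 [[|[|[|//]]] Hi].
- by rewrite (bool_irrelevance Hi isT).
- by rewrite (bool_irrelevance Hi isT).
- by rewrite (bool_irrelevance Hi isT).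
Qed.

Definition out (x : flow) (i : letter) : int :=
  match val i with
  | 0%N => x12 x + x13 x | 1%N => x23 x + x21 x | _ => x31 x + x32 x
  end.

Definition fcoef (x : flow) (i j : letter) : int :=
  match val i, val j with
  | 0%N, 1%N => x12 x | 1%N, 2%N => x23 x | 2%N, 0%N => x31 x
  | 1%N, 0%N => x21 x | 2%N, 1%N => x32 x | 0%N, 2%N => x13 x
  | _, _ => 0
  end.

Definition from_to (s t : letter) (x : flow) :=
  [&& t12 x - t31 x == (s == 0 :> nat)%:Z - (t == 0 :> nat)%:Z,
      t23 x - t12 x == (s == 1 :> nat)%:Z - (t == 1 :> nat)%:Z
    & t31 x - t23 x == (s == 2 :> nat)%:Z - (t == 2 :> nat)%:Z].

Lemma wflowP (s : letter) (p : seq letter) : path neq_letter s p ->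
  [&& nonneg (wflow s p), flen (wflow s p) == (size p)%:Z & from_to s (last s p) (wflow s p)].
Proof.
elim: p s => [|u p IH] s /=; first by move: s; apply: letterP.
move=> /andP[su /IH]; move: (wflow u p) (last u p) (size p) su.
rewrite /from_to /nonneg /flen /t12 /t23 /t31 => w t k.
by move: s; apply: letterP; move: u; apply: letterP => //= _; lia.
Qed.

Lemma wflow_trailvec (s : letter) (p : seq letter) :
  path neq_letter s p -> trailvec (size p) (wflow s p).
Proof.
move=> /wflowP; rewrite /trailvec /from_to; move: (wflow s p) (last s p) => w t.
by move: s; apply: letterP; move: t; apply: letterP => /=; lia.
Qed.

Lemma exists_letter (P : letter -> bool) :
  [|| P (@Ordinal 3 0 isT), P (@Ordinal 3 1 isT) | P (@Ordinal 3 2 isT)] -> exists u, P u.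
Proof. by case/or3P => Pu; eexists; exact: Pu. Qed.

(** Fleury's rule. If the edge from [s] to [t] would leave a nonempty remainder avoiding [t], that
    remainder is balanced on the other two vertices, so an edge leads from [s] to the third one. *)
Lemma euler_step (L : nat) (s t : letter) (x : flow) :
  nonneg x -> flen x == L.+1%:Z -> from_to s t x -> (s == t) ==> (0 < out x s) ->
  exists u, [&& s != u, 0 < fcoef x s u
             & (u == t) ==> (L == 0)%N || (0 < out (fsub x (edge s u)) t)].
Proof.
move=> x0 xL xst xs; apply: exists_letter; move: x0 xL xst xs.
rewrite /nonneg /flen /from_to /t12 /t23 /t31.
by move: s; apply: letterP; move: t; apply: letterP; rewrite /out /fcoef /=; lia.
Qed.

Lemma euler_trail (L : nat) (s t : letter) (x : flow) :
  nonneg x -> flen x == L%:Z -> from_to s t x ->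
  (s == t) ==> (L == 0)%N || (0 < out x s) ->
  exists p, [/\ size p = L, path neq_letter s p, last s p = t & wflow s p = x].
Proof.
elim: L s x => [|L IH] s x x0 xL xst xs.
  exists [::]; split => //=.
    by move: s t xst x0 xL {xs}; rewrite /from_to /nonneg /flen /t12 /t23 /t31;
      do 2! apply: letterP => //=; lia.
  case: x x0 xL {xst xs} => a b c d e f; rewrite /nonneg /flen /fzero /= => *.
  by congr Flow; lia.
have [u /and3P[su xsu ut]] := euler_step x0 xL xst xs.
have [] := IH u (fsub x (edge s u)).
- move: s u su xsu x0 {xL xst xs ut}; rewrite /nonneg /fcoef.
  by do 2! apply: letterP => //=; lia.
- move: s u su xsu xL {x0 xst xs ut}; rewrite /flen /fcoef.
  by do 2! apply: letterP => //=; lia.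
- move: s u t su xst {IH x0 xL xs ut xsu}; rewrite /from_to /t12 /t23 /t31.
  by do 3! apply: letterP => //=; lia.
- by move: ut; case: eqP => // ->.
move=> p [sp pp lp wp]; exists (u :: p); split => //=; first by rewrite sp.
  by rewrite /neq_letter su.
by rewrite wp faddBK.
Qed.

Lemma trailvec_trail (L : nat) (x : flow) : trailvec L x ->
  exists s p, [/\ size p = L, path neq_letter s p & wflow s p = x].
Proof.
move=> xL.
suff [s [t]] : exists s t, from_to s t x && ((s == t) ==> (L == 0)%N || (0 < out x s)).
  case/andP: (xL) => x0 /andP[xs _] /andP[xst st].
  by have [p [sp pp _ wp]] := euler_trail x0 xs xst st; exists s, p.
pose i0 := @Ordinal 3 0 isT; pose i1 := @Ordinal 3 1 isT; pose i2 := @Ordinal 3 2 isT.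
case/and4P: xL => x0 xL d1 /andP[d2 d3].
have [d1E|[d1E|d1E]] : t12 x - t31 x = 1 \/ t12 x - t31 x = -1 \/ t12 x = t31 x by lia.
- have [d2E|d2E] : t23 x - t12 x = -1 \/ t23 x = t12 x by lia.
    by exists i0, i1; rewrite /from_to /=; lia.
  by exists i0, i2; rewrite /from_to /=; lia.
- have [d2E|d2E] : t23 x - t12 x = 1 \/ t23 x = t12 x by lia.
    by exists i1, i0; rewrite /from_to /=; lia.
  by exists i2, i0; rewrite /from_to /=; lia.
have [d2E|[d2E|d2E]] : t23 x - t12 x = 1 \/ t23 x - t12 x = -1 \/ t23 x = t12 x by lia.
- by exists i1, i2; rewrite /from_to /=; lia.
- by exists i2, i1; rewrite /from_to /=; lia.
have bal s : from_to s s x by rewrite /from_to; lia.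
(* A closed trail must start at a vertex with edges; if [i0] has none, all edges run between the
   other two vertices. *)
have [o0|o0] := boolP (0 < out x i0); first by exists i0, i0; rewrite bal o0 orbT.
exists i1, i1; rewrite bal eqxx /=; move: d1E d2E xL x0 o0 {d1 d2 d3 bal}.
by rewrite /nonneg /flen /out /t12 /t23 /t31 /=; lia.
Qed.

(** * Sums of trails: cutting and padding *)

Inductive splits (n : nat) : nat -> flow -> Prop :=
| splits0 : splits n 0 fzero
| splitsS N y x : trailvec n y -> splits n N x -> splits n N.+1 (fadd y x).

Lemma splits_add (n M N : nat) (x y : flow) :
  splits n M x -> splits n N y -> splits n (M + N) (fadd x y).
Proof.
move=> dx dy; elim: dx => [|M' u w ku _ IH]; first by rewrite fadd0.
by rewrite -faddA addSn; apply: splitsS.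
Qed.

(* An Euler trail of length [l * n] is cut into [l] trails of length [n]. *)
Lemma splits_chop (n l : nat) (x : flow) : trailvec (l * n) x -> splits n l x.
Proof.
case/trailvec_trail => s [p []] + + <- {x}.
elim: l s p => [|l IH] s p sp pp; first by case: p sp pp => // _ _; exact: splits0.
rewrite -(cat_take_drop n p) wflow_cat.
move: pp; rewrite -{1}(cat_take_drop n p) cat_path => /andP[p1 p2].
apply: splitsS; last by apply: IH p2; rewrite size_drop sp mulSn addKn.
have {1}<- : size (take n p) = n by rewrite size_takel // sp mulSn leq_addr.
exact: wflow_trailvec.
Qed.

(** Two-cycles have length 2 and leave the [t] unchanged, so adding enough of them to [c.2] gives a
    trail vector of length [c.1 * n]. *)
Definition core_ok (n : nat) (c : nat * flow) :=
  [&& nonneg c.2, `|t12 c.2 - t31 c.2| <= 1, `|t23 c.2 - t12 c.2| <= 1,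
      `|t31 c.2 - t23 c.2| <= 1, flen c.2 <= (c.1 * n)%N%:Z
    & (2 %| ((c.1 * n)%N%:Z - flen c.2))%Z].

Definition fsum (cs : seq (nat * flow)) := foldr (fun c => fadd c.2) fzero cs.

(* The cores are padded with the two-cycles [r]; the circulation [y] and
   what is left of [r] form a closed trail. *)
Lemma splits_fill (n : nat) (cs : seq (nat * flow)) (N : nat) (r1 r2 r3 : int) (y : flow) :
  all (core_ok n) cs -> 0 <= r1 -> 0 <= r2 -> 0 <= r3 ->
  nonneg y -> t12 y = t23 y -> t23 y = t31 y ->
  let x := fadd (fsum cs) (fadd (Flow r1 r2 r3 r1 r2 r3) y) in
  flen x = (N * n)%N%:Z -> (sumn (map fst cs) <= N)%N ->
  flen y + (sumn (map fst cs) * n)%N%:Z <= (N * n)%N%:Z ->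
  splits n N x.
Proof.
elim: cs N r1 r2 r3 => [|[l u] cs IH] N r1 r2 r3 /= + r10 r20 r30 y0 y12 y23 xN lN yN.
  move=> _; apply: splits_chop; move: y0 y12 y23 xN.
  by rewrite /trailvec /nonneg /flen /t12 /t23 /t31 /=; lia.
case/andP=> uok csok.
pose f := (((l * n)%N%:Z - flen u) %/ 2)%Z.
have fE : (l * n)%N%:Z = flen u + 2 * f by move: uok; rewrite /core_ok /= /f; lia.
have f0 : 0 <= f by move: uok; rewrite /core_ok /=; lia.
have fle : f <= r1 + r2 + r3.
  move: xN yN; rewrite mulnDl.
  have -> : flen (fadd (fadd u (fsum cs)) (fadd (Flow r1 r2 r3 r1 r2 r3) y))
     = flen u + flen (fsum cs) + 2 * (r1 + r2 + r3) + flen y.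
    by rewrite /flen /=; lia.
  have : flen (fsum cs) <= (sumn (map fst cs) * n)%N%:Z.
    elim: cs {IH lN} csok => [|[l' u'] cs IH] /=; first by rewrite /flen /=; lia.
    by case/andP => + /IH; rewrite /core_ok /= mulnDl /flen /=; lia.
  by lia.
have [f1 [f2 [f3 [f1r f2r f3r f123]]]] : exists f1 f2 f3,
    [/\ 0 <= f1 <= r1, 0 <= f2 <= r2, 0 <= f3 <= r3 & f = f1 + f2 + f3].
  exists (Num.min r1 f), (Num.min r2 (f - Num.min r1 f)).
  by exists (f - Num.min r1 f - Num.min r2 (f - Num.min r1 f)); split; lia.
have -> : fadd (fadd u (fsum cs)) (fadd (Flow r1 r2 r3 r1 r2 r3) y) =
  fadd (fadd u (Flow f1 f2 f3 f1 f2 f3))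
    (fadd (fsum cs) (fadd (Flow (r1 - f1) (r2 - f2) (r3 - f3) (r1 - f1) (r2 - f2) (r3 - f3)) y)).
  by rewrite /fadd /=; congr Flow; lia.
have lN' : (l <= N)%N by lia.
have NE : (N * n = l * n + (N - l) * n)%N by rewrite -mulnDl subnKC.
rewrite -(subnKC lN'); apply: splits_add.
  apply: splits_chop; case/and5P: uok => /= u0 u1 u2 u3 _; apply/and5P; split.
  - by move: u0; rewrite /nonneg /=; lia.
  - by move: fE f123; rewrite /flen /=; lia.
  - by move: u1; rewrite /t12 /t31 /=; lia.
  - by move: u2; rewrite /t12 /t23 /=; lia.
  - by move: u3; rewrite /t23 /t31 /=; lia.
apply: IH => //; try lia.
by move: xN fE; rewrite NE /flen /=; lia.
Qed.

(** * Cores with prescribed skew part *)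

(* A trail with [t = (k + 1, k, k)] if [sbeta], and [t = (k, k, k - 1)] otherwise, of
   length [slen * n], where [k] may range over [slo, slo + 2, ..., shi]. *)
Record spec := Spec { sbeta : bool; slen : nat; slo : int; shi : int }.

(** The shortest flow with the given [t]: positive parts along the cycle, negative parts against
    it. *)
Definition core (be : bool) (k : int) : flow :=
  Flow (Num.max (k + (be : nat)%:Z) 0) (Num.max k 0) (Num.max (k - (~~ be : nat)%:Z) 0)
       (Num.max (- (k + (be : nat)%:Z)) 0) (Num.max (- k) 0) (Num.max (- (k - (~~ be : nat)%:Z)) 0).

Lemma core_nonneg be k : nonneg (core be k).
Proof. by rewrite /nonneg /core /=; lia. Qed.

Lemma flen_core be k : flen (core be k) = `|3 * k - 1 + (2 * be)%N%:Z|.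
Proof. by case: be; rewrite /flen /core /=; lia. Qed.

Lemma core_t be k :
  [/\ t12 (core be k) = k + (be : nat)%:Z, t23 (core be k) = k
    & t31 (core be k) = k - (~~ be : nat)%:Z].
Proof. by rewrite /t12 /t23 /t31 /core /=; split; lia. Qed.

Lemma core_neg_le be (lo k : int) : lo <= k ->
  [/\ x21 (core be k) <= x21 (core be lo), x32 (core be k) <= x32 (core be lo)
    & x13 (core be k) <= x13 (core be lo)].
Proof. by move=> lok; rewrite /core /=; split; lia. Qed.

(** The last two inequalities keep the core lengths of [flen_core] within [slen s * n] on the whole
    range; the parities make the gap even. *)
Definition spec_ok (n : nat) (s : spec) :=
  [&& slo s <= shi s, (2 %| (shi s - slo s))%Z,
      (2 %| ((slen s * n)%N%:Z - slo s - 1))%Z,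
      0 <= 3 * slo s - 1 + (2 * sbeta s)%N%:Z + (slen s * n)%N%:Z
    & 3 * shi s - 1 + (2 * sbeta s)%N%:Z <= (slen s * n)%N%:Z].

Definition ssum (f : spec -> int) (ss : seq spec) : int := \sum_(s <- ss) f s.

(* The numbers of edges against the cycle decrease with [k], so that the value at [slo]
   bounds them on the whole range. *)
Definition spneg (s : spec) := core (sbeta s) (slo s).

Definition scount (be : bool) (s : spec) : int := (sbeta s == be : nat)%:Z.

Definition slenz (s : spec) : int := (slen s)%:Z.

Lemma ssum0 f : ssum f [::] = 0. Proof. exact: big_nil. Qed.
Lemma ssumS f s ss : ssum f (s :: ss) = f s + ssum f ss. Proof. exact: big_cons. Qed.
Lemma ssum_cat f ss1 ss2 : ssum f (ss1 ++ ss2) = ssum f ss1 + ssum f ss2.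
Proof. exact: big_cat. Qed.
Lemma ssum_nseq f s k : ssum f (nseq k s) = k%:Z * f s.
Proof. by rewrite /ssum big_nseq iter_addr addr0 -mulr_natl natz. Qed.

Lemma choose_cores (n : nat) (ss : seq spec) (z : int) :
  all (spec_ok n) ss -> ssum slo ss <= z <= ssum shi ss -> (2 %| (z - ssum slo ss))%Z ->
  exists cs, let u := fsum cs in
    [/\ all (core_ok n) cs, (sumn (map fst cs))%:Z = ssum slenz ss &
    [&& t12 u == z + ssum (scount true) ss, t23 u == z, t31 u == z - ssum (scount false) ss,
        x21 u <= ssum (x21 \o spneg) ss, x32 u <= ssum (x32 \o spneg) ss
      & x13 u <= ssum (x13 \o spneg) ss]].
Proof.
elim: ss z => [|[be l lo hi] ss IH] z; rewrite ?ssum0 ?ssumS.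
  by move=> _ z0 _; exists [::]; split => //=; rewrite ?ssum0 /t12 /t23 /t31 /=; lia.
case/andP => sok ssok zb z2.
have ssp : ssum slo ss <= ssum shi ss /\ (2 %| (ssum shi ss - ssum slo ss))%Z.
  elim: ss ssok {IH zb z2} => [|s ss IH] /=; rewrite ?ssum0 ?ssumS //.
  by case/andP; rewrite /spec_ok => ? /IH; lia.
have [k [klo khi kz k2]] : exists k, [/\ lo <= k, k <= hi,
    ssum slo ss <= z - k <= ssum shi ss & (2 %| (k - lo))%Z].
  (* Greedy choice: the largest [k] that leaves the others at least the sum of their lower ends. *)
  exists (Num.min hi (z - ssum slo ss)).
  by move: sok zb z2; rewrite /spec_ok /=; split; lia.
have [//||cs [csok cl ct]] := IH (z - k) ssok; first by move: z2; rewrite /=; lia.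
have [T12 T23 T31] := core_t be k; have [n1 n2 n3] := core_neg_le be klo.
exists ((l, core be k) :: cs); split => /=.
- rewrite csok andbT /core_ok /= core_nonneg T12 T23 T31 flen_core.
  by move: sok klo khi k2; rewrite /spec_ok /=; clear; case: be => /=; lia.
- by rewrite -cl /slenz /=; lia.
- move: ct T12 T23 T31 n1 n2 n3; rewrite /spneg /scount /t12 /t23 /t31 /=; clear.
  by case: be => /=; lia.
Qed.

(** The cores account for a part [Z] of [z]; the rest is carried by [z - Z] copies of the cycle 1 ->
    2 -> 3 -> 1, which must fit into the words that the cores do not use. *)
Lemma assemble (n N : nat) (x : flow) (z : int) (ss : seq spec) :
  (2 <= n)%N -> nonneg x -> flen x = (N * n)%N%:Z -> all (spec_ok n) ss ->
  t12 x = z + ssum (scount true) ss -> t23 x = z -> t31 x = z - ssum (scount false) ss ->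
  ssum (x21 \o spneg) ss <= x21 x -> ssum (x32 \o spneg) ss <= x32 x ->
  ssum (x13 \o spneg) ss <= x13 x ->
  ssum slenz ss <= N%:Z -> ssum slo ss <= z ->
  3 * z <= 3 * ssum shi ss + n%:Z * (N%:Z - ssum slenz ss) -> splits n N x.
Proof.
move=> n2 x0 xN ssok t12x t23x t31x q1 q2 q3 lN loz zhi.
have ssp : ssum slo ss <= ssum shi ss /\ (2 %| (ssum shi ss - ssum slo ss))%Z.
  elim: ss ssok {t12x t31x q1 q2 q3 lN loz zhi} => [|s ss IH] /=; rewrite ?ssum0 ?ssumS //.
  by case/andP; rewrite /spec_ok => ? /IH; lia.
have sspar : (2 %| (n%:Z * ssum slenz ss - ssum slo ss - ssum (scount true) ss
   - ssum (scount false) ss))%Z.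
  elim: ss ssok {t12x t31x q1 q2 q3 lN loz zhi ssp} => [|s ss IH] /=; rewrite ?ssum0 ?ssumS //.
    by rewrite mulr0.
  rewrite mulrDr.
  case/andP=> + /IH; rewrite /spec_ok PoszM -[Posz (slen s)]/(slenz s).
  by rewrite /(scount true s) /(scount false s); case: (sbeta s) => /=; lia.
set lo := ssum slo ss in loz ssp sspar *; set hi := ssum shi ss in zhi ssp.
set h := N%:Z - ssum slenz ss in zhi.
have xpar : (2 %| (z - lo - n%:Z * h))%Z.
  move: sspar xN; rewrite /h mulrBr PoszM; move: t12x t23x t31x.
  by rewrite /t12 /t23 /t31 /flen; lia.
(* If [z <= hi] has the wrong parity, one 3-cycle is left over; [n * h] is then odd by [xpar], and
   so at least 3. *)
have nh : (2 %| (n%:Z * h))%Z || (3 <= n%:Z * h).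
  have h0 : 0 <= h by rewrite /h; lia.
  have [->|h1] : h = 0 \/ 1 <= h by lia.
    by rewrite mulr0.
  have [->|n3] : n = 2%N \/ (3 <= n)%N by lia.
    by apply/orP; left; apply: dvdz_mulr.
  by apply/orP; right; nia.
pose Z := if z <= hi then (if (2 %| (z - lo))%Z then z else z - 1) else hi.
have Zlohi : lo <= Z <= hi by rewrite /Z; move: loz ssp; do ?case: ifP => /=; lia.
have Zpar : (2 %| (Z - lo))%Z by rewrite /Z; move: loz ssp; do ?case: ifP => /=; lia.
have Zz : Z <= z by rewrite /Z; do ?case: ifP => /=; lia.
have Zh : 3 * (z - Z) <= n%:Z * h.
  have h0 : 0 <= n%:Z * h by apply: mulr_ge0; rewrite /h; lia.
  by rewrite /Z; do ?case: ifP => /=; lia.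
have [cs [csok cl ct]] := choose_cores ssok Zlohi Zpar.
move: ct; set u := fsum cs => ct.
have xE : x = fadd u (fadd (Flow (x21 x - x21 u) (x32 x - x32 u) (x13 x - x13 u)
      (x21 x - x21 u) (x32 x - x32 u) (x13 x - x13 u)) (Flow (z - Z) (z - Z) (z - Z) 0 0 0)).
  move: ct t12x t23x t31x {xN x0 q1 q2 q3}; rewrite /t12 /t23 /t31.
  by case: x u => ? ? ? ? ? ? [? ? ? ? ? ?] /= *; rewrite /fadd /=; congr Flow; lia.
rewrite xE; apply: splits_fill => //=; try lia.
- by rewrite /nonneg /=; lia.
- by rewrite -/u -xE.
- rewrite [flen _]/flen /= PoszM cl; move: Zh; rewrite /h mulrBr PoszM; lia.
Qed.

Definition block (c : int) (s : spec) : seq spec := nseq `|c|%N s.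

Lemma ssum_block f c s : 0 <= c -> ssum f (block c s) = c * f s.
Proof. by move=> c0; rewrite ssum_nseq gez0_abs. Qed.

Lemma all_block n c s : 0 <= c -> (0 < c) ==> spec_ok n s -> all (spec_ok n) (block c s).
Proof. by move=> c0 cs; rewrite all_nseq; move: (spec_ok n s) cs => ok; lia. Qed.

(** * Sorted flows: explicit trails by the residues of [n] modulo 2 and 3 *)

Definition ncyc (x : flow) := x21 x + x32 x + x13 x.

(* The source [1] has excess [a + b], the sinks [2] and [3] have excess [b] and [a].
   Of the [N] words only [a + b] need be open trails; each of the [y] spare ones can be
   used to lengthen an open trail from [n] to [2 * n]. *)
Definition sorted_flow (n N : nat) (x : flow) (z a b y : int) :=
  [&& (2 <= n)%N, nonneg x, flen x == (N * n)%N%:Z, t12 x == z + b, t23 x == z,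
      t31 x == z - a, 0 <= a, 0 <= b, 0 <= z, 0 <= y & N%:Z == a + b + y].

Lemma sorted_flen n N x z a b y : sorted_flow n N x z a b y ->
  n%:Z * (a + b + y) = 3 * z + b - a + 2 * ncyc x.
Proof.
case/and3P=> _ _ /and4P[/eqP xN + + /andP[+ /and5P[_ _ _ _ /eqP <-]]].
by move: xN; rewrite PoszM /flen /t12 /t23 /t31 /ncyc; lia.
Qed.

Lemma sorted_splits n N x z a b y (ss : seq spec) : sorted_flow n N x z a b y ->
  all (spec_ok n) ss ->
  ssum (scount true) ss = b -> ssum (scount false) ss = a ->
  ssum (x21 \o spneg) ss <= x21 x -> ssum (x32 \o spneg) ss <= x32 x ->
  ssum (x13 \o spneg) ss <= x13 x ->
  ssum slenz ss <= a + b + y -> ssum slo ss <= z ->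
  3 * z <= 3 * ssum shi ss + n%:Z * (a + b + y - ssum slenz ss) -> splits n N x.
Proof.
move=> /and3P[n2 x0 /and4P[/eqP xN /eqP t12x /eqP t23x /andP[/eqP t31x /and5P[_ _ _ _ /eqP Ny]]]].
move=> ssok sb sa q1 q2 q3; rewrite -Ny => *.
by apply: (@assemble n N x z ss); rewrite ?sb ?sa.
Qed.

Ltac blocks_sum := rewrite ?ssum_cat !ssum_block /scount /slenz /spneg /=; lia.

(** For even [n] every [k] is odd. As [z < a + b], the values 1 and -1 suffice: [h] trails get -1,
    the others 1, with sum exactly [z]. *)
Lemma splits_even_small n N x z a b y : sorted_flow n N x z a b y ->
  (2 %| n)%N -> z < a + b -> b <= x31 x + x13 x -> a <= x12 x + x21 x ->
  a + b <= x23 x + x32 x ->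
  (n == 2)%N ==> ((2 * b <= ncyc x + 2 * y) && (2 * a <= x12 x + x23 x + x31 x + 2 * y)) ->
  splits n N x.
Proof.
move=> sx n2 zm s3 s1 s2 h2.
have tot := sorted_flen sx.
pose h := ((a + b - z) %/ 2)%Z.
have hE : a + b = z + 2 * h.
  case: (dvdnP n2) tot => k ->; rewrite /h PoszM; lia.
(* The value -1 goes first to trails [(0, -1, -1)], of core length 2. The cores [(2, 1, 1)] and
   [(-1, -1, -2)] have length 4 and take two words if [n = 2]. *)
pose e := Num.min b h; pose f := h - e; pose l := if (n == 2)%N then 2%N else 1%N.
have := sx; rewrite /sorted_flow /nonneg /t12 /t23 /t31 => sx'.
have e0 : 0 <= e by rewrite /e; lia.
have be0 : 0 <= b - e by rewrite /e; lia.
have f0 : 0 <= f by rewrite /f /e; lia.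
have af0 : 0 <= a - f by rewrite /f /e; lia.
apply: (sorted_splits (ss := block e (Spec true 1 (-1) (-1)) ++ block (b - e) (Spec true l 1 1)
   ++ block f (Spec false l (-1) (-1)) ++ block (a - f) (Spec false 1 1 1)) sx).
- rewrite !all_cat; apply/and4P; split; apply: all_block => //;
    by rewrite /spec_ok /= /l; case: (n =P 2%N); lia.
1-5: by blocks_sum.
- rewrite ?ssum_cat !ssum_block // /slenz /= /l; move: tot h2; rewrite /ncyc.
  by case: (n =P 2%N) => [->|_]; lia.
- by blocks_sum.
rewrite ?ssum_cat !ssum_block // /slenz /= /l.
have : 0 <= n%:Z * (a + b + y - (e * 1 + ((b - e) * l%:Z + (f * l%:Z + (a - f) * 1)))).
  apply: mulr_ge0 => //; rewrite /l; move: tot h2; rewrite /ncyc.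
  by case: (n =P 2%N) => [->|_]; lia.
by rewrite /l; lia.
Qed.

Ltac unfold_sorted sx tot sx' :=
  have tot := sorted_flen sx; move: tot; rewrite /ncyc => tot;
  have := sx; rewrite /sorted_flow /nonneg /t12 /t23 /t31 => sx'.

Ltac blocks_ok :=
  rewrite !all_cat; repeat (apply/andP; split); apply: all_block; rewrite /spec_ok /=; lia.

(** [K - 1] is the largest odd [k] fitting into length [n]. With [z] eliminated by [sorted_flen],
    the last condition of [sorted_splits] becomes [2 * a + b <= ncyc x]. *)
Lemma splits_even_large0 n N x z a b y K : sorted_flow n N x z a b y ->
  n = (3 * K)%N -> (2 %| n)%N -> a + b <= z -> 2 * a + b <= ncyc x -> splits n N x.
Proof.
move=> sx nK n2 zm; rewrite /ncyc => c0; unfold_sorted sx tot sx'; rewrite {}nK in n2 tot sx sx' *.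
apply: (sorted_splits (ss := block b (Spec true 1 1 (K%:Z - 1)) ++
  block a (Spec false 1 1 (K%:Z - 1))) sx); first by blocks_ok.
all: by blocks_sum.
Qed.

Lemma splits_even_large1 n N x z a b y K : sorted_flow n N x z a b y ->
  n = (3 * K + 1)%N -> (2 %| n)%N -> a + b <= z -> a <= ncyc x + y -> splits n N x.
Proof.
move=> sx nK n2 zm; rewrite /ncyc => c0; unfold_sorted sx tot sx'; rewrite {}nK in n2 tot sx sx' *.
(* The core [(K, K, K - 1)] falls two edges short of [n], but [(2K + 1, 2K + 1, 2K)] fills [2 * n]
   exactly, so as many trails as possible are lengthened. *)
have [y2 y2E] : exists y2, y2 = Num.min a y by exists (Num.min a y).
apply: (sorted_splits (ss := block b (Spec true 1 1 K) ++
  block (a - y2) (Spec false 1 1 K) ++ block y2 (Spec false 2 1 (2 * K%:Z + 1))) sx);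
  first by blocks_ok.
all: by blocks_sum.
Qed.

Lemma splits_even_large2 n N x z a b y K : sorted_flow n N x z a b y ->
  n = (3 * K + 2)%N -> (2 %| n)%N -> a + b <= z -> 2 * b <= ncyc x + 2 * y -> splits n N x.
Proof.
move=> sx nK n2 zm; rewrite /ncyc => c0; unfold_sorted sx tot sx'; rewrite {}nK in n2 tot sx sx' *.
have [y2 y2E] : exists y2, y2 = Num.min b y by exists (Num.min b y).
have K0 : K = 0%N -> b <= y by move=> K0; move: tot; rewrite K0; lia.
apply: (sorted_splits (ss := block (b - y2) (Spec true 1 1 (K%:Z - 1)) ++
  block y2 (Spec true 2 1 (2 * K%:Z + 1)) ++ block a (Spec false 1 1 (K%:Z + 1))) sx);
  first by blocks_ok.
all: by blocks_sum.
Qed.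

(* For odd [n], a trail with [t = (k, k, k - 1)] has [k] even if its length is [n], and uses an
   edge 13 if [k = 0]. There being only [x13 x] of these edges, at least [g] such trails
   need [k > 0], that is, [k = 2] or length [2 * n]. *)
Lemma splits_odd0 n N x z a b y K : sorted_flow n N x z a b y ->
  n = (3 * K)%N -> ~~ (2 %| n)%N -> a <= x31 x + x13 x + y -> 2 * a + b <= ncyc x -> splits n N x.
Proof.
move=> sx nK n2 s3; rewrite /ncyc => c0; unfold_sorted sx tot sx'; rewrite {}nK in n2 tot sx sx' *.
have [g gE] : exists g, g = Num.max 0 (a - x13 x) by exists (Num.max 0 (a - x13 x)).
(* Length [2 * n] is even and allows [k = 1]. If [g > 0] then [x31 x = z - g], so the sum
   [2 * g - y2] of the lower ends is at most [z] by [s3] or [0 <= x31 x]. *)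
have [y2 y2E] : exists y2, y2 = Num.min g y by exists (Num.min g y).
(* For [n = 3], [k = 2] does not fit into one word; here the edge count gives [z <= y], while
   [g <= z]. *)
have K1 : K = 1%N -> g <= y by move=> K1; move: tot; rewrite K1; lia.
apply: (sorted_splits (ss := block b (Spec true 1 0 (K%:Z - 1)) ++
  block y2 (Spec false 2 1 (2 * K%:Z - 1)) ++ block (g - y2) (Spec false 1 2 (K%:Z - 1)) ++
  block (a - g) (Spec false 1 0 (K%:Z - 1))) sx); first by blocks_ok.
all: by blocks_sum.
Qed.

Lemma splits_odd_small1 n N x z a b y K : sorted_flow n N x z a b y ->
  n = (3 * K + 1)%N -> ~~ (2 %| n)%N -> z < 2 * a -> a <= x31 x + x13 x + y -> splits n N x.
Proof.
move=> sx nK n2 za s3; unfold_sorted sx tot sx'; rewrite {}nK in n2 tot sx sx' *.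
have [g gE] : exists g, g = Num.max 0 (a - x13 x) by exists (Num.max 0 (a - x13 x)).
have [y2 y2E] : exists y2, y2 = Num.min g y by exists (Num.min g y).
have K2 : 2 * (a + b + y) <= K%:Z * (a + b + y) by apply: ler_wpM2r; lia.
apply: (sorted_splits (ss := block b (Spec true 1 0 K) ++
  block y2 (Spec false 2 1 (2 * K%:Z + 1)) ++ block (g - y2) (Spec false 1 2 K) ++
  block (a - g) (Spec false 1 0 K)) sx); first by blocks_ok.
all: by blocks_sum.
Qed.

(** [2 * a <= z] lets every trail [(k, k, k - 1)] have [k > 0], so no edge 13 is used; the upper
    ends are those of [splits_even_large1]. *)
Lemma splits_odd_large1 n N x z a b y K : sorted_flow n N x z a b y ->
  n = (3 * K + 1)%N -> ~~ (2 %| n)%N -> 2 * a <= z -> a <= ncyc x + y -> splits n N x.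
Proof.
move=> sx nK n2 za; rewrite /ncyc => c0; unfold_sorted sx tot sx'; rewrite {}nK in n2 tot sx sx' *.
have [y2 y2E] : exists y2, y2 = Num.min a y by exists (Num.min a y).
apply: (sorted_splits (ss := block b (Spec true 1 0 K) ++
  block y2 (Spec false 2 1 (2 * K%:Z + 1)) ++ block (a - y2) (Spec false 1 2 K)) sx);
  first by blocks_ok.
all: by blocks_sum.
Qed.

Lemma splits_odd_small2 n N x z a b y K : sorted_flow n N x z a b y ->
  n = (3 * K + 2)%N -> ~~ (2 %| n)%N -> z < 2 * a + Num.min b y ->
  a <= x31 x + x13 x + y -> splits n N x.
Proof.
move=> sx nK n2 za s3; unfold_sorted sx tot sx'; rewrite {}nK in n2 tot sx sx' *.
have [g gE] : exists g, g = Num.max 0 (a - x13 x) by exists (Num.max 0 (a - x13 x)).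
have [y2 y2E] : exists y2, y2 = Num.min g y by exists (Num.min g y).
have K2 : a + b + y <= K%:Z * (a + b + y) by apply: ler_peMl; lia.
apply: (sorted_splits (ss := block b (Spec true 1 0 (K%:Z - 1)) ++
  block y2 (Spec false 2 1 (2 * K%:Z + 1)) ++ block (g - y2) (Spec false 1 2 (K%:Z + 1)) ++
  block (a - g) (Spec false 1 0 (K%:Z + 1))) sx); first by blocks_ok.
all: by blocks_sum.
Qed.

(** The threshold [2 * a + Num.min b y] is the sum of the lower ends of the trails used here. *)
Lemma splits_odd_large2 n N x z a b y K : sorted_flow n N x z a b y ->
  n = (3 * K + 2)%N -> ~~ (2 %| n)%N -> 2 * a + Num.min b y <= z ->
  2 * b <= ncyc x + 2 * y -> splits n N x.
Proof.
move=> sx nK n2 za; rewrite /ncyc => c0; unfold_sorted sx tot sx'; rewrite {}nK in n2 tot sx sx' *.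
have [y2 y2E] : exists y2, y2 = Num.min b y by exists (Num.min b y).
apply: (sorted_splits (ss := block (b - y2) (Spec true 1 0 (K%:Z - 1)) ++
  block y2 (Spec true 2 1 (2 * K%:Z + 1)) ++ block a (Spec false 1 2 (K%:Z + 1))) sx);
  first by blocks_ok.
all: by blocks_sum.
Qed.

(** * Valid inequalities on the cone *)

Definition dot (c x : flow) : int :=
  x12 c * x12 x + x23 c * x23 x + x31 c * x31 x +
  (x21 c * x21 x + x32 c * x32 x + x13 c * x13 x).

(* Membership in [N] times the convex hull of the trails of length [n], in dual form. *)
Definition conic (n N : nat) (x : flow) : Prop :=
  flen x = (N * n)%N%:Z /\
  forall c k, (forall y, trailvec n y -> 0 <= dot c y + k) -> 0 <= dot c x + k * N%:Z.

Ltac on_trails :=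
  let y := fresh "y" in
  move=> y; rewrite /trailvec /nonneg /flen /t12 /t23 /t31 /dot /=; lia.

Ltac conclude := rewrite /dot /t12 /t23 /t31 /ncyc /=; lia.

Lemma mod3_cases (n : nat) :
  exists K, [\/ n = (3 * K)%N, n = (3 * K + 1)%N | n = (3 * K + 2)%N].
Proof.
exists (n %/ 3)%N.
have /or3P[/eqP h|/eqP h|/eqP h] : [|| n == 3 * (n %/ 3), n == 3 * (n %/ 3) + 1
  | n == 3 * (n %/ 3) + 2]%N by lia.
- exact: Or31.
- exact: Or32.
- exact: Or33.
Qed.

Lemma conic_sorted_splits (n N : nat) (x : flow) : (2 <= n)%N -> conic n N x ->
  t31 x <= t23 x -> t23 x <= t12 x -> 0 <= t23 x -> splits n N x.
Proof.
move=> n2 [xN H] t32 t21 t20.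
(* Each use of [H] checks an inequality on trails, where the residues of [n] enter, and carries it
   over to [x]. The coefficients are those of right side minus left side; the constant is the factor
   of [N]. *)
have a1 : 0 <= x12 x by have := H (Flow 1 0 0 0 0 0) 0 ltac:(on_trails); conclude.
have a2 : 0 <= x23 x by have := H (Flow 0 1 0 0 0 0) 0 ltac:(on_trails); conclude.
have a3 : 0 <= x31 x by have := H (Flow 0 0 1 0 0 0) 0 ltac:(on_trails); conclude.
have a4 : 0 <= x21 x by have := H (Flow 0 0 0 1 0 0) 0 ltac:(on_trails); conclude.
have a5 : 0 <= x32 x by have := H (Flow 0 0 0 0 1 0) 0 ltac:(on_trails); conclude.
have a6 : 0 <= x13 x by have := H (Flow 0 0 0 0 0 1) 0 ltac:(on_trails); conclude.
have mN : t12 x - t31 x <= N%:Z.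
  by have := H (Flow (-1) 0 1 1 0 (-1)) 1 ltac:(on_trails); conclude.
pose a := t23 x - t31 x; pose b := t12 x - t23 x; pose y := N%:Z - a - b.
have sx : sorted_flow n N x (t23 x) a b y.
  by rewrite /sorted_flow /nonneg /y /b /a; lia.
have [ev|od] := boolP (2 %| n)%N.
  (* On a trail of even length the [t] have even sum: if two of them differ by 1, the third is odd,
     hence nonzero. *)
  have s1 : a <= x12 x + x21 x.
    by have := H (Flow 1 (-1) 1 1 1 (-1)) 0 ltac:(on_trails); rewrite /a; conclude.
  have s2 : a + b <= x23 x + x32 x.
    by have := H (Flow (-1) 1 1 1 1 (-1)) 0 ltac:(on_trails); rewrite /a /b; conclude.
  have s3 : b <= x31 x + x13 x.
    by have := H (Flow (-1) 1 1 1 (-1) 1) 0 ltac:(on_trails); rewrite /b; conclude.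
  have [zm|mz] := ltrP (t23 x) (a + b).
    apply: (splits_even_small sx) => //; apply/implyP => /eqP nn; rewrite nn in H.
    apply/andP; split; rewrite /y /a /b.
      by have := H (Flow (-4) 2 2 5 (-1) (-1)) 2 ltac:(on_trails); conclude.
    by have := H (Flow (-1) (-1) 5 2 2 (-4)) 2 ltac:(on_trails); conclude.
  have [K [nK|nK|nK]] := mod3_cases n.
  - apply: (splits_even_large0 sx nK) => //; rewrite /y /a /b.
    by have := H (Flow (-1) (-1) 2 2 2 (-1)) 0 ltac:(on_trails); conclude.
  - apply: (splits_even_large1 sx nK) => //; rewrite /y /a /b.
    by have := H (Flow (-1) (-1) 2 2 2 (-1)) 1 ltac:(on_trails); conclude.
  - apply: (splits_even_large2 sx nK) => //; rewrite /y /a /b.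
    by have := H (Flow (-4) 2 2 5 (-1) (-1)) 2 ltac:(on_trails); conclude.
have s3 : a <= x31 x + x13 x + y.
  by have := H (Flow (-1) (-1) 3 1 1 (-1)) 1 ltac:(on_trails); rewrite /y /a /b; conclude.
have [K [nK|nK|nK]] := mod3_cases n.
- apply: (splits_odd0 sx nK) => //; rewrite /y /a /b.
  by have := H (Flow (-1) (-1) 2 2 2 (-1)) 0 ltac:(on_trails); conclude.
- have [za|az] := ltrP (t23 x) (2 * a); first exact: (splits_odd_small1 sx nK).
  apply: (splits_odd_large1 sx nK) => //; rewrite /y /a /b.
  by have := H (Flow (-1) (-1) 2 2 2 (-1)) 1 ltac:(on_trails); conclude.
- have [za|az] := ltrP (t23 x) (2 * a + Num.min b y); first exact: (splits_odd_small2 sx nK).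
  apply: (splits_odd_large2 sx nK) => //; rewrite /y /a /b.
  by have := H (Flow (-4) 2 2 5 (-1) (-1)) 2 ltac:(on_trails); conclude.
Qed.

(** * Reduction to sorted flows by symmetry *)

(* The reversal of all edges, and two transpositions of letters composed with it. *)
Definition frev (x : flow) := Flow (x21 x) (x32 x) (x13 x) (x12 x) (x23 x) (x31 x).
Definition fswapl (x : flow) := Flow (x23 x) (x12 x) (x31 x) (x32 x) (x21 x) (x13 x).
Definition fswapr (x : flow) := Flow (x12 x) (x31 x) (x23 x) (x21 x) (x13 x) (x32 x).

Definition flow_sym (f : flow -> flow) :=
  [/\ f fzero = fzero, {morph f : x y / fadd x y}, involutive f
    & [/\ forall x, flen (f x) = flen x, forall c x, dot (f c) (f x) = dot c x
      & forall n x, trailvec n (f x) = trailvec n x]].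

Lemma frev_sym : flow_sym frev.
Proof.
split=> // [[]|] //; split=> [x|c x|n x]; rewrite ?/trailvec ?/nonneg;
  by rewrite ?/dot ?/flen ?/t12 ?/t23 ?/t31 /=; lia.
Qed.

Lemma fswapl_sym : flow_sym fswapl.
Proof.
split=> // [[]|] //; split=> [x|c x|n x]; rewrite ?/trailvec ?/nonneg;
  by rewrite ?/dot ?/flen ?/t12 ?/t23 ?/t31 /=; lia.
Qed.

Lemma fswapr_sym : flow_sym fswapr.
Proof.
split=> // [[]|] //; split=> [x|c x|n x]; rewrite ?/trailvec ?/nonneg;
  by rewrite ?/dot ?/flen ?/t12 ?/t23 ?/t31 /=; lia.
Qed.

Lemma splits_by_sym (f : flow -> flow) (n N : nat) (x : flow) : flow_sym f ->
  (conic n N (f x) -> splits n N (f x)) -> conic n N x -> splits n N x.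
Proof.
move=> [f0 fD fK [flenf fdot ftr]] Hf [xN H].
have fdec N' y : splits n N' y -> splits n N' (f y).
  by elim=> [|N'' u w ku _]; rewrite ?f0 ?fD; [apply: splits0 | apply: splitsS; rewrite ftr].
rewrite -[x]fK; apply/fdec/Hf; split => [|c k Hc]; first by rewrite flenf.
rewrite -[c]fK fdot; apply: H => y ty.
by rewrite -[y]fK fdot; apply: Hc; rewrite ftr.
Qed.

Lemma conic_splits (n N : nat) (x : flow) : (2 <= n)%N -> conic n N x -> splits n N x.
Proof.
move=> n2.
have sort_pos y : t31 y <= t23 y -> t23 y <= t12 y -> 0 <= t23 y -> conic n N y -> splits n N y.
  by move=> h1 h2 h3 cy; apply: conic_sorted_splits.
have sort3 y : t31 y <= t23 y -> t23 y <= t12 y -> conic n N y -> splits n N y.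
  move=> h1 h2; have [h3|h3] := lerP 0 (t23 y); first exact: sort_pos.
  (* Reversal negates the [t]; three adjacent swaps then restore their order. *)
  apply: (splits_by_sym frev_sym); apply: (splits_by_sym fswapl_sym).
  apply: (splits_by_sym fswapr_sym); apply: (splits_by_sym fswapl_sym).
  by apply: sort_pos; move: h1 h2 h3; rewrite /t12 /t23 /t31 /=; lia.
have sort2 y : t31 y <= t12 y -> t31 y <= t23 y -> conic n N y -> splits n N y.
  move=> h1 h2; have [h3|h3] := lerP (t23 y) (t12 y); first exact: sort3.
  apply: (splits_by_sym fswapl_sym).
  by apply: sort3; move: h1 h2 h3; rewrite /t12 /t23 /t31 /=; lia.
have sort1 y : t23 y <= t12 y -> conic n N y -> splits n N y.
  move=> h1; have [h3|h3] := lerP (t31 y) (t23 y); first exact: sort3.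
  apply: (splits_by_sym fswapr_sym).
  by apply: sort2; move: h1 h3; rewrite /t12 /t23 /t31 /=; lia.
have [h|h] := lerP (t23 x) (t12 x); first exact: sort1.
apply: (splits_by_sym fswapl_sym).
by apply: sort1; move: h; rewrite /t12 /t23 /t31 /=; lia.
Qed.

(** * Words as flows, and the columns of the design matrix *)

Lemma fcoefD (x y : flow) (i j : letter) : fcoef (fadd x y) i j = fcoef x i j + fcoef y i j.
Proof. by move: i; apply: letterP; move: j; apply: letterP; rewrite /fcoef /= ?addr0. Qed.

Lemma fcoef_edge (s u i j : letter) : i != j ->
  fcoef (edge s u) i j = ((s == i) && (u == j) : nat)%:Z.
Proof.
by move: i; apply: letterP; move: j; apply: letterP => //= _;
  move: s; apply: letterP; move: u; apply: letterP.
Qed.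

Lemma sum_fcoef_wflow (s : letter) (p : seq letter) (i j : letter) : i != j ->
  (\sum_(l < size p) ((nth ord0 (s :: p) l == i) && (nth ord0 p l == j)))%N%:Z
    = fcoef (wflow s p) i j.
Proof.
move=> ij; elim: p s => [|u p IH] s /=.
  by rewrite big_ord0; move: i j {ij}; do 2! apply: letterP.
by rewrite big_ord_recl /= PoszD fcoefD fcoef_edge // -IH.
Qed.

Lemma xcountE (n : nat) (w : n.+1.-tuple letter) (i j : letter) : i != j ->
  (xcount i j w)%:Z = fcoef (wflow (thead w) (behead w)) i j.
Proof.
move=> ij; rewrite -sum_fcoef_wflow // /xcount -sum1_card big_mkcond /=.
have -> : size (behead w) = n by rewrite size_behead size_tuple.
congr Posz; apply: eq_bigr => l _; rewrite inE.
by case/tupleP: w => s p; rewrite theadE /=; case: ifP.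
Qed.

Lemma is_wordE (n : nat) (w : n.+1.-tuple letter) :
  is_word w = path neq_letter (thead w) (behead w).
Proof.
have sz : size (behead w) = n by rewrite size_behead size_tuple.
apply/forallP/(pathP ord0) => [H l|H l].
  rewrite sz => ln; have := H (Ordinal ln).
  by case/tupleP: w {H sz} => s p; rewrite theadE.
have := H l; rewrite sz => /(_ (ltn_ord l)).
by case/tupleP: w {H sz} => s p; rewrite theadE.
Qed.

Definition vec_flow (v : 'I_6 -> int) : flow :=
  Flow (v (@Ordinal 6 0 isT)) (v (@Ordinal 6 3 isT)) (v (@Ordinal 6 4 isT))
       (v (@Ordinal 6 2 isT)) (v (@Ordinal 6 5 isT)) (v (@Ordinal 6 1 isT)).

Lemma vec_flow_inj (u v : 'I_6 -> int) : vec_flow u = vec_flow v -> u =1 v.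
Proof.
case=> ? ? ? ? ? ? [[|[|[|[|[|[|//]]]]]] Hk]; by rewrite (bool_irrelevance Hk isT).
Qed.

Definition word_flow (T : nat) (w : T.-tuple letter) : flow :=
  vec_flow (fun k => (Aentry k w)%:Z).

Lemma word_flowE (n : nat) (w : n.+1.-tuple letter) :
  word_flow w = wflow (thead w) (behead w).
Proof.
have in0 : inord 0 = @Ordinal 3 0 isT by apply: val_inj; rewrite /= inordK.
have in1 : inord 1 = @Ordinal 3 1 isT by apply: val_inj; rewrite /= inordK.
have in2 : inord 2 = @Ordinal 3 2 isT by apply: val_inj; rewrite /= inordK.
rewrite /word_flow /vec_flow /Aentry /row_pair /= in0 in1 in2 !xcountE //.
by case: wflow.
Qed.

Lemma word_trailvec (n : nat) (w : n.+1.-tuple letter) :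
  is_word w -> trailvec n (word_flow w).
Proof.
rewrite is_wordE word_flowE => /wflow_trailvec.
by rewrite size_behead size_tuple.
Qed.

Lemma trailvec_word (n : nat) (x : flow) : trailvec n x ->
  exists2 w : n.+1.-tuple letter, is_word w & word_flow w = x.
Proof.
case/trailvec_trail => s [p [sp pp <-]].
have sz : size (s :: p) == n.+1 by rewrite /= sp.
have th : thead (Tuple sz) = s by rewrite /thead (tnth_nth s).
by exists (Tuple sz); rewrite ?is_wordE ?word_flowE th.
Qed.

Lemma splits_in_NA (n N : nat) (x : flow) (v : 'I_6 -> int) :
  splits n N x -> vec_flow v = x -> in_NA n.+1 v.
Proof.
move=> dx; elim: dx v => [|{x}N' y x ty _ IH] v vx.
  by exists (fun _ => 0%N) => k; rewrite big1 // (vec_flow_inj (v := fun _ => 0) vx).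
have [w ww wy] := trailvec_word ty.
have vx' : vec_flow (fun k => v k - (Aentry k w)%:Z) = x.
  move: vx; rewrite -wy; case: x {IH} => ? ? ? ? ? ? [*].
  by rewrite /vec_flow; congr Flow; lia.
have [c cE] := IH _ vx'.
exists (fun u => ((u == w) + c u)%N) => k; have /eqP := cE k.
rewrite subr_eq => /eqP ->; under [RHS]eq_bigr do rewrite mulnDl PoszD.
rewrite big_split /= addrC; congr (_ + _).
rewrite (bigD1 w) //= eqxx mul1n big1 ?addr0 // => u /andP[_ /negPf ->].
by rewrite mul0n.
Qed.

Lemma dot_word_sum (R : comNzRingType) (T : nat) (v : 'I_6 -> int) (a : T.-tuple letter -> R) :
  (forall k, (v k)%:~R = \sum_(w : T.-tuple letter | is_word w) a w * (Aentry k w)%:R) ->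
  forall c, (dot c (vec_flow v))%:~R =
    \sum_(w : T.-tuple letter | is_word w) a w * (dot c (word_flow w))%:~R.
Proof.
move=> vE [c1 c2 c3 c4 c5 c6]; rewrite /dot /= !rmorphD !rmorphM /= !vE !mulr_sumr -!big_split /=.
by apply: eq_bigr => w _; rewrite !rmorphD !rmorphM /= !mulrDr !(mulrCA (a w)).
Qed.

Lemma flen_dot (x : flow) : flen x = dot (Flow 1 1 1 1 1 1) x.
Proof. by rewrite /flen /dot /=; lia. Qed.

(** The integer coefficients make the length of [v] a multiple of [n]; the real ones have the same
    sum, which is therefore a natural number [N], and as weights they carry inequalities from words
    to [v]. *)
Lemma in_ZA_cone_conic (R : realType) (n : nat) (v : 'I_6 -> int) : (0 < n)%N ->
  in_ZA n.+1 v -> in_cone R n.+1 v -> exists N, conic n N (vec_flow v).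
Proof.
move=> n0 [a va] [b [b0 vb]].
have flen_word (w : n.+1.-tuple letter) : is_word w -> dot (Flow 1 1 1 1 1 1) (word_flow w) = n.
  by move=> /word_trailvec /andP[_ /andP[/eqP <- _]]; rewrite flen_dot.
have lenZ : flen (vec_flow v) = n%:Z * \sum_(w : n.+1.-tuple letter | is_word w) a w.
  have va' k : (v k)%:~R = \sum_(w : n.+1.-tuple letter | is_word w) a w * (Aentry k w)%:R :> int.
    by rewrite intz va; apply: eq_bigr => w _; rewrite natz.
  have := dot_word_sum va' (Flow 1 1 1 1 1 1); rewrite intz flen_dot => ->.
  by rewrite mulr_sumr; apply: eq_bigr => w ww; rewrite intz flen_word // mulrC.
have lenR : (flen (vec_flow v))%:~R = n%:R * \sum_(w : n.+1.-tuple letter | is_word w) b w :> R.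
  rewrite flen_dot (dot_word_sum vb) mulr_sumr.
  by apply: eq_bigr => w ww; rewrite flen_word // mulrC.
set A := \sum_(w | _) a w in lenZ; set B := \sum_(w | _) b w in lenR.
have nR : n%:R != 0 :> R by rewrite pnatr_eq0 -lt0n.
have AB : A%:~R = B.
  by apply: (mulfI nR); rewrite -lenR lenZ rmorphM.
have A0 : 0 <= A by rewrite -(ler0z R) AB sumr_ge0.
exists `|A|%N; split=> [|c k H].
  by rewrite lenZ PoszM gez0_abs // mulrC.
rewrite -(ler0z R) gez0_abs // rmorphD rmorphM /= AB (dot_word_sum vb) mulr_sumr -big_split /=.
apply: sumr_ge0 => w ww; rewrite mulrC -mulrDl -rmorphD mulr_ge0 // ler0z.
exact/H/word_trailvec.
Qed.

Lemma in_NA_ZA (T : nat) (v : 'I_6 -> int) : in_NA T v -> in_ZA T v.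
Proof. by case=> c vc; exists (fun w => (c w)%:Z) => k; rewrite vc. Qed.

Lemma in_NA_cone (R : realType) (T : nat) (v : 'I_6 -> int) : in_NA T v -> in_cone R T v.
Proof.
case=> c vc; exists (fun w => (c w)%:R); split=> [w|k]; first exact: ler0n.
by rewrite vc rmorph_sum /=; apply: eq_bigr => w _; rewrite -natrM.
Qed.

Unset Implicit Arguments.

Theorem theorem2 (R : realType) (T : nat) (hT : (3 <= T)%N) (v : 'I_6 -> int) :
  in_NA T v <-> (in_ZA T v /\ in_cone R T v).
Proof.
split=> [NAv|[ZAv conev]]; first by split; [apply: in_NA_ZA | apply: in_NA_cone].
case: T hT ZAv conev => // n n2 ZAv conev.
have [N cv] := in_ZA_cone_conic (ltnW n2) ZAv conev.
exact: splits_in_NA (conic_splits n2 cv) erefl.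
Qed.
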